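(* There exist positive constants $C$ and $n_0$ such that for every non-decreasing function $f:\mathbb{N}\to\mathbb{N}$ with $n\leqslant f(n)\leqslant R(K_n)$ for all $n\in\mathbb{N}$, there exists a sequence of connected graphs $(G_n)_{n\in\mathbb{N}}$ such that for all $n\geqslant n_0$, $|V(G_n)|=n$ and $$f(n)\leqslant R(G_n)\leqslant C f(n).$$
   Context: For a graph $G$, the (two-colour) Ramsey number $R(G)$ is the smallest integer $N$ such that every colouring of the edges of the complete graph $K_N$ with two colours contains a copy of $G$ all of whose edges have the same colour. $K_n$ denotes the complete graph on $n$ vertices. *)

(* Defs.v *)
From Stdlib Require Import ClassicalEpsilon.
From mathcomp Require Import all_boot.
Set Implicit Arguments. Unset Strict Implicit. Unset Printing Implicit Defensive.

Definition simple_graph (V : finType) (G : rel V) : Prop :=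
  symmetric G /\ irreflexive G.

Definition connected_graph (V : finType) (G : rel V) : Prop :=
  forall x y : V, connect G x y.

Definition complete_graph (n : nat) : rel 'I_n := fun x y => x != y.
Arguments complete_graph n : clear implicits.

(* K_N -> G: every 2-colouring c of the edges of K_N (a symmetric colour
   function on pairs of vertices; the values on the diagonal are irrelevant)
   contains a copy of G (an injective map phi of V(G) into V(K_N)) all of
   whose edges get the same colour b. *)
Definition arrows (V : finType) (G : rel V) (N : nat) : bool :=
  [forall c : {ffun 'I_N * 'I_N -> bool},
     [forall u, forall v, c (u, v) == c (v, u)] ==>
     [exists phi : {ffun V -> 'I_N},
        injectiveb phi &&
        [exists b : bool,
           [forall x, forall y, G x y ==> (c (phi x, phi y) == b)]]]].

(* The Ramsey number R(G): the least N with K_N -> G (such N always exists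
   by Ramsey's theorem; the value 0 in the impossible other case is a
   dummy). *)
Definition ramsey (V : finType) (G : rel V) : nat :=
  match excluded_middle_informative (exists N, arrows G N) with
  | left h => ex_minn h
  | right _ => 0
  end.

(* Main.v *)
(* Let [G(k, n)] be [K_k] with [n - k] pendant edges attached at one of its
   vertices, so that [G(1, n)] is a star, with Ramsey number at most [2 n], and
   [G(n, n) = K_n]. It suffices that [R(G(k+1, n)) = O(R(G(k, n)))]: then the
   first [k] with [R(G(k, n)) >= f(n)] gives the required graph.

   Let [M = R(G(k, n))] and suppose a colouring of [200 M] vertices has no
   monochromatic [G(k+1, n)]. Inside a large "blue" neighbourhood there is no
   blue [K_k], and Burr's bound [M > (k-1)(n-1)] leaves a set [A] of at least
   [98 M] vertices of red degree [>= n-1] in the whole colouring. So [A] has no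
   red [K_{k+1}], and every red degree inside [A] is below [M]. Now argue as
   Erdos and Szemeredi: if [X] is a maximum blue clique in [A], of size [t < k],
   then many vertices of [A] have at most [t/64] red neighbours in [X]; by
   pigeonhole a large part [U'] of them is joined in blue to [X \ S] for a single
   [S] with [|S| <= t/64]. Then [U'] has no blue clique larger than [t/64] and no
   red [K_{k+1}], so [M] is exponentially smaller than Erdos' lower bound
   [2^(k/2)]. *)
Require Import Defs.
From mathcomp Require Import all_boot.
From mathcomp Require Import zify.

Set Implicit Arguments. Unset Strict Implicit. Unset Printing Implicit Defensive.

(** * Monochromatic sets and neighbourhoods *)

Definition mono (T : finType) (c : rel T) (b : bool) (Q : {set T}) : Prop :=
  {in Q &, forall x y, x != y -> c x y = b}.

(** The vertex itself is excluded because diagonal values of a colouring are arbitrary. *)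
Definition nbrs (T : finType) (c : rel T) (b : bool) (x : T) : {set T} :=
  [set y | (y != x) && (c x y == b)].

(** The graph [G(k, n)]: vertex 0 is the centre of the star, and the clique is on the vertices below
    [k]. *)
Definition star_clique (k n : nat) : rel 'I_n :=
  fun i j => (i != j) && [|| i == 0 :> nat, j == 0 :> nat | (i < k) && (j < k)].

Lemma mono0 (T : finType) (c : rel T) b : mono c b set0.
Proof. by move=> x y; rewrite inE. Qed.

Lemma monoU (T : finType) (c : rel T) b (P Q : {set T}) :
  symmetric c -> mono c b P -> mono c b Q ->
  {in P & Q, forall x y, c x y = b} -> mono c b (P :|: Q).
Proof.
move=> cC mP mQ PQ x y /setUP[xP|xQ] /setUP[yP|yQ] neq.
- exact: mP.
- exact: PQ.
- by rewrite cC; apply: PQ.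
- exact: mQ.
Qed.

Lemma monoU1 (T : finType) (c : rel T) b x (Q : {set T}) :
  symmetric c -> mono c b Q -> Q \subset nbrs c b x -> mono c b (x |: Q).
Proof.
move=> cC mQ /subsetP sQ; apply: monoU => //.
  by move=> y z /set1P-> /set1P->; rewrite eqxx.
by move=> y z /set1P-> /sQ; rewrite inE => /andP[_ /eqP].
Qed.

Lemma nbrs_notin (T : finType) (c : rel T) b x (Q : {set T}) :
  Q \subset nbrs c b x -> x \notin Q.
Proof. by move/subsetP=> sQ; apply/negP=> /sQ; rewrite inE eqxx. Qed.

Lemma cardU1_nbrs (T : finType) (c : rel T) b x (Q : {set T}) :
  Q \subset nbrs c b x -> #|x |: Q| = #|Q|.+1.
Proof. by move/nbrs_notin=> xQ; rewrite cardsU1 xQ. Qed.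

Lemma nbrs_split (T : finType) (c : rel T) b x (U : {set T}) :
  x \in U -> #|U| = (#|U :&: nbrs c b x| + #|U :&: nbrs c (~~ b) x|).+1.
Proof.
move=> xU; rewrite (cardsD1 x U) xU add1n; congr _.+1.
rewrite -(cardsID (nbrs c b x) (U :\ x)); congr (_ + _); apply: eq_card => y;
  rewrite !inE; case: (y \in U); case: (y == x); case: (c x y); case: b => //.
Qed.

(* The weights [1 + 1/q] and [q + 1] have reciprocals summing to 1, which turns
   the Erdos-Szekeres recursion into this bound. *)
Lemma card_no_mono (T : finType) (c : rel T) q r a b (U : {set T}) :
  symmetric c ->
  (forall Q : {set T}, Q \subset U -> mono c r Q -> #|Q| < a) ->
  (forall Q : {set T}, Q \subset U -> mono c (~~ r) Q -> #|Q| < b) ->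
  #|U|.+1 * q ^ a <= q.+1 ^ (a + b).
Proof.
move=> cC; elim: a b U => [|a IHa] b U Ha.
  by have := Ha set0 (sub0set _) (@mono0 _ _ _); rewrite cards0.
elim: b U Ha => [|b IHb] U Ha Hb.
  by have := Hb set0 (sub0set _) (@mono0 _ _ _); rewrite cards0.
case: (set_0Vmem U) => [->|[x xU]].
  rewrite cards0 mul1n; apply: leq_trans (_ : q.+1 ^ a.+1 <= _).
    by rewrite leq_exp2r.
  by rewrite leq_pexp2l // leq_addr.
have ext e (Q : {set T}) : Q \subset U :&: nbrs c e x -> mono c e Q ->
    [/\ x |: Q \subset U, mono c e (x |: Q) & #|x |: Q| = #|Q|.+1].
  rewrite subsetI => /andP[QU Qn] mQ.
  split; [by rewrite subUset sub1set xU | exact: monoU1 | exact: cardU1_nbrs Qn].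
have Ir : #|U :&: nbrs c r x|.+1 * q ^ a <= q.+1 ^ (a + b.+1).
  apply: IHa => Q sQ mQ.
    by have [sxQ mxQ E] := ext _ _ sQ mQ; have := Ha _ sxQ mxQ; rewrite E.
  by apply: Hb => //; apply: subset_trans sQ (subsetIl _ _).
have Ib : #|U :&: nbrs c (~~ r) x|.+1 * q ^ a.+1 <= q.+1 ^ (a.+1 + b).
  apply: IHb => Q sQ mQ.
    by apply: Ha => //; apply: subset_trans sQ (subsetIl _ _).
  by have [sxQ mxQ E] := ext _ _ sQ mQ; have := Hb _ sxQ mxQ; rewrite E.
(* [|U| + 1] is the sum of the two neighbourhood sizes, each plus one, and [(q+1)^(a+b) / q^a]
   satisfies this recursion exactly. *)
rewrite (nbrs_split c r xU); move: Ir Ib.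
rewrite !addnS !addSn !expnS; nia.
Qed.

(** * Common neighbourhoods and maximum cliques *)

(** The vertices of [X] are treated in turn. The part of [U] joined in colour [b] is kept if its
    proportion is at least [q/(q+1)]; otherwise the other part, of proportion at least [1/(q+1)], is
    kept and the vertex goes into [S]. *)
Lemma common_nbrs (T : finType) (c : rel T) q b (X : seq T) (U : {set T}) :
  0 < q -> uniq X ->
  exists S U' : {set T},
    [/\ {subset S <= X}, U' \subset U,
        forall x y, x \in X -> x \notin S -> y \in U' -> c x y = b,
        forall x y, x \in S -> y \in U' -> c x y = ~~ b
      & #|U| * q ^ size X <= q.+1 ^ size X * (q ^ #|S| * #|U'|)].
Proof.
move=> q0; elim: X U => [|x X IH] U /=.
  move=> _; exists set0, U; split=> //.
  - by move=> x; rewrite inE.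
  - by move=> x y; rewrite inE.
  - by rewrite cards0 /= !expn0 muln1 !mul1n.
case/andP=> xX /IH{}IH.
pose Ub := [set y in U | c x y == b]; pose Ur := [set y in U | c x y == ~~ b].
have EU : #|U| = #|Ub| + #|Ur|.
  rewrite -(cardsID [set y | c x y == b] U); congr (_ + _); apply: eq_card => y;
    by rewrite !inE; case: (y \in U); case: (c x y); case: (b).
have [le|lt] := leqP (#|U| * q) (q.+1 * #|Ub|).
  have [S [U' [sS sU Hb Hr Hc]]] := IH Ub.
  exists S, U'; split.
  - by move=> y /sS yX; rewrite inE yX orbT.
  - by apply: subset_trans sU _; apply/subsetP=> y; rewrite inE => /andP[].
  - move=> y z; rewrite inE => /orP[/eqP->|yX] yS zU; last exact: Hb.
    by move/subsetP: sU => /(_ _ zU); rewrite inE => /andP[_ /eqP].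
  - exact: Hr.
  - rewrite !expnS mulnA; apply: leq_trans (leq_mul le (leqnn _)) _.
    by rewrite -!mulnA leq_mul2l /=.
have {}lt : #|U| <= q.+1 * #|Ur| by nia.
have [S [U' [sS sU Hb Hr Hc]]] := IH Ur.
have xS : x \notin S by apply/negP=> /sS; rewrite (negPf xX).
exists (x |: S), U'; split.
- by move=> y /setU1P[->|/sS yX]; rewrite inE ?eqxx ?yX ?orbT.
- by apply: subset_trans sU _; apply/subsetP=> y; rewrite inE => /andP[].
- move=> y z; rewrite !inE negb_or => /orP[/eqP->|yX]; first by rewrite eqxx.
  by case/andP=> _ yS zU; apply: Hb.
- move=> y z /setU1P[->|yS] zU; last exact: Hr.
  by move/subsetP: sU => /(_ _ zU); rewrite inE => /andP[_ /eqP].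
- rewrite cardsU1 xS add1n !expnS.
  move: (q ^ size X) (q.+1 ^ size X) (q ^ #|S|) Hc lt => u v w Hc lt.
  apply: leq_trans (_ : q.+1 * #|Ur| * (q * u) <= _); first exact: leq_mul.
  rewrite -[leqLHS]mulnA [#|Ur| * _]mulnCA -[leqRHS]mulnA leq_mul2l /=.
  by rewrite [leqRHS](_ : _ = q * (v * (w * #|U'|))) ?leq_mul2l ?Hc ?orbT //; nia.
Qed.

Lemma max_mono (T : finType) (c : rel T) b (A : {set T}) :
  exists X : {set T}, [/\ X \subset A, mono c b X &
    forall Q : {set T}, Q \subset A -> mono c b Q -> #|Q| <= #|X|].
Proof.
pose P (Q : {set T}) := (Q \subset A) &&
  [forall x in Q, forall y in Q, (x != y) ==> (c x y == b)].
have PP (Q : {set T}) : reflect (Q \subset A /\ mono c b Q) (P Q).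
  apply: (iffP andP) => [[-> H]|[-> H]]; split=> //.
    move=> x y xQ yQ neq.
    by move/forall_inP: H => /(_ _ xQ) /forall_inP /(_ _ yQ); rewrite neq => /eqP.
  apply/forall_inP=> x xQ; apply/forall_inP=> y yQ; apply/implyP=> neq.
  by rewrite H.
have P0 : P set0 by apply/PP; split; [exact: sub0set | exact: mono0].
case: (arg_maxnP (fun Q : {set T} => #|Q|) P0) => X /PP[XA mX] max.
by exists X; split=> // Q QA mQ; apply: max; apply/PP.
Qed.

Lemma leq_card_bigcup (I T : finType) (X : {set I}) (F : I -> {set T}) :
  #|\bigcup_(i in X) F i| <= \sum_(i in X) #|F i|.
Proof.
elim/big_rec2: _ => [|i m S _ H]; first by rewrite cards0.
by apply: leq_trans (leq_card_setU _ _) _; rewrite leq_add2l.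
Qed.

(** By maximality every vertex of [B] outside [X] has a neighbour in [X] in the other colour, so [B]
    is covered by [|X|] closed neighbourhoods of size at most [d]. *)
Lemma card_max_mono (T : finType) (c : rel T) b d (B X : {set T}) :
  symmetric c -> X \subset B -> mono c b X ->
  (forall Q : {set T}, Q \subset B -> mono c b Q -> #|Q| <= #|X|) ->
  {in B, forall x, #|B :&: nbrs c (~~ b) x| < d} ->
  #|B| <= #|X| * d.
Proof.
move=> cC XB mX max deg.
have cover : B \subset \bigcup_(x in X) (x |: B :&: nbrs c (~~ b) x).
  apply/subsetP=> y yB; apply: contraT => /bigcupP nex.
  have yX : X \subset nbrs c b y.
    apply/subsetP=> x xX; rewrite inE; apply/andP; split.
      by apply/eqP=> E; apply: nex; exists x; rewrite // !inE E eqxx.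
    apply/negPn/negP=> ncb; apply: nex; exists x => //.
    rewrite !inE yB /= cC; case: eqP => //= _.
    by move: ncb; case: (c y x); case: (b).
  have := max (y |: X); rewrite (cardU1_nbrs yX) ltnn => -> //.
    by rewrite subUset sub1set yB.
  exact: monoU1.
apply: leq_trans (subset_leq_card cover) _.
rewrite -sum_nat_const; apply: leq_trans (leq_card_bigcup _ _) _.
apply: leq_sum => x xX; rewrite (cardU1_nbrs (subsetIr _ _)).
by apply: deg; apply: (subsetP XB).
Qed.

(** * The arrow relation and Ramsey numbers *)

(** Pulling [c] back along an injection of ['I_M] into [B] lets the arrow property be used inside
    any large vertex set. *)
Lemma arrows_embed (n : nat) (G : rel 'I_n) M (T : finType) (c : rel T) (B : {set T}) :
  arrows G M -> symmetric c -> M <= #|B| ->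
  exists b (phi : 'I_n -> T), [/\ injective phi, forall i, phi i \in B &
    forall i j, G i j -> c (phi i) (phi j) = b].
Proof.
move=> /forallP arr cC MB.
pose h (i : 'I_M) := enum_val (widen_ord MB i).
have hI : injective h by move=> i j /enum_val_inj/(congr1 val)/= /val_inj.
pose d := [ffun p => c (h p.1) (h p.2)].
have dC : [forall u, forall v, d (u, v) == d (v, u)].
  by apply/forallP=> u; apply/forallP=> v; rewrite !ffunE /= cC.
have /implyP/(_ dC)/existsP[phi /andP[/injectiveP phiI /existsP[b /forallP H]]] := arr d.
exists b, (h \o phi); split.
- exact: inj_comp.
- by move=> i; apply: enum_valP.
- by move=> i j; have /forallP/(_ j)/implyP H' := H i => /H'; rewrite ffunE => /eqP.
Qed.

Lemma eq_arrows (V : finType) (G H : rel V) N : G =2 H -> arrows G N = arrows H N.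
Proof.
move=> E; apply: eq_forallb => c; congr (_ ==> _).
apply: eq_existsb => phi; congr (_ && _); apply: eq_existsb => b.
by apply: eq_forallb => x; apply: eq_forallb => y; rewrite E.
Qed.

Lemma arrows_ramsey (V : finType) (G : rel V) N : arrows G N -> arrows G (ramsey G).
Proof.
rewrite /ramsey => aN; case: ClassicalEpsilon.excluded_middle_informative.
  by move=> ex; case: ex_minnP.
by case; exists N.
Qed.

Lemma ramsey_leq (V : finType) (G : rel V) N : arrows G N -> ramsey G <= N.
Proof.
rewrite /ramsey => aN; case: ClassicalEpsilon.excluded_middle_informative => //.
by move=> ex; case: ex_minnP => m _; apply.
Qed.

Lemma eq_ramsey (V : finType) (G H : rel V) : G =2 H -> ramsey G = ramsey H.
Proof.
move=> E; apply/eqP; rewrite eqn_leq; rewrite /ramsey.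
case: ClassicalEpsilon.excluded_middle_informative => [e1|n1];
case: ClassicalEpsilon.excluded_middle_informative => [e2|n2] //.
- case: ex_minnP => m aG minG; case: ex_minnP => p aH minH.
  by rewrite minG ?minH // 1?(eq_arrows _ E) // -(eq_arrows _ E).
- by case: n2; case: e1 => N aN; exists N; rewrite -(eq_arrows _ E).
- by case: n1; case: e2 => N aN; exists N; rewrite (eq_arrows _ E).
Qed.

(** * Copies of [star_clique] in a colouring *)

Lemma star_clique_simple k n : simple_graph (@star_clique k n).
Proof.
split=> [i j|i]; rewrite /star_clique ?eqxx // eq_sym.
by rewrite orbCA [(i < k) && _]andbC.
Qed.

Lemma star_clique_connected k n : connected_graph (@star_clique k n).
Proof.
case: n => [|n] x y; first by case: x.
have to0 z : connect (@star_clique k n.+1) z ord0.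
  case: (eqVneq z ord0) => [->|neq]; first exact: connect0.
  by apply: connect1; rewrite /star_clique neq eqxx orbT.
have symG : connect_sym (@star_clique k n.+1).
  by apply: sym_connect_sym; case: (star_clique_simple k n.+1).
by apply: connect_trans (to0 x) _; rewrite symG.
Qed.

Lemma star_clique_complete n : @star_clique n n =2 complete_graph n.
Proof. by move=> i j; rewrite /star_clique !ltn_ord !orbT andbT. Qed.

Lemma star_clique_arrows k n N :
  0 < k <= n ->
  (forall c : rel 'I_N, symmetric c -> exists b x Q,
     [/\ mono c b Q, x \in Q, k <= #|Q| & n.-1 <= #|nbrs c b x|]) ->
  arrows (@star_clique k n) N.
Proof.
case/andP=> k0 kn H; apply/forallP=> d; apply/implyP=> /forallP dC.
pose c : rel 'I_N := fun x y => d (x, y).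
have cC : symmetric c by move=> x y; have /forallP/(_ y)/eqP := dC x.
have [b [x [Q [mQ xQ cQ nx]]]] := H c cC.
(* The centre, the rest of the clique, then the other neighbours: entry [i] is the image of vertex
   [i]. *)
pose s := x :: enum (Q :\ x) ++ enum (nbrs c b x :\: Q).
have us : uniq s.
  rewrite /= cat_uniq !enum_uniq /= mem_cat !mem_enum !inE eqxx xQ /= andbT.
  by apply/hasPn=> y; rewrite !mem_enum !inE => /andP[/negPf-> _]; rewrite andbF.
have cQ1 : k.-1 <= #|Q :\ x| by move: cQ; rewrite (cardsD1 x) xQ; lia.
have ss : n <= size s.
  rewrite /= size_cat -!cardE.
  have := cardsID Q (nbrs c b x).
  have : #|nbrs c b x :&: Q| <= #|Q :\ x|.
    by apply/subset_leq_card/subsetP=> y; rewrite !inE => /andP[/andP[-> _] ->].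
  by lia.
have sI (i j : 'I_n) : i != j -> nth x s i != nth x s j.
  by move=> neq; rewrite nth_uniq // ?(leq_trans (ltn_ord _) ss).
have sQ (i : 'I_n) : i < k -> nth x s i \in Q.
  case: i => [[|i] ilt] //= ik; rewrite nth_cat -cardE.
  have il : i < #|Q :\ x| by lia.
  rewrite il; have : nth x (enum (Q :\ x)) i \in enum (Q :\ x).
    by apply: mem_nth; rewrite -cardE.
  by rewrite mem_enum inE => /andP[].
have s0 (i j : 'I_n) : i != j -> i = 0 :> nat -> c (nth x s i) (nth x s j) = b.
  move=> neq i0; rewrite i0 /=.
  have : nth x s j \in s by apply: mem_nth; apply: leq_trans (ltn_ord _) ss.
  have := sI _ _ neq; rewrite i0 /= inE eq_sym => /negPf nx0; rewrite nx0 /=.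
  rewrite mem_cat !mem_enum !inE nx0 => /orP[/= jQ|/andP[_ /eqP//]].
  by apply: mQ => //; rewrite eq_sym nx0.
apply/existsP; exists [ffun i : 'I_n => nth x s i]; apply/andP; split.
  apply/injectiveP=> i j; rewrite !ffunE => /eqP E; apply/eqP.
  by apply: contraLR E => /sI.
apply/existsP; exists b; apply/forallP=> i; apply/forallP=> j; apply/implyP.
rewrite !ffunE => /andP[neq /or3P[/eqP i0|/eqP j0|/andP[ik jk]]]; apply/eqP.
- exact: s0.
- by rewrite -[d _]/(c _ _) cC s0 // eq_sym.
- by apply: mQ; rewrite ?sQ // sI.
Qed.

Lemma arrows_star_clique k n M (T : finType) (c : rel T) (B : {set T}) :
  k <= n -> arrows (@star_clique k n) M -> symmetric c -> M <= #|B| ->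
  exists b (Q : {set T}), [/\ Q \subset B, mono c b Q & #|Q| = k].
Proof.
move=> kn arr cC MB.
have [b [phi [phiI phiB H]]] := arrows_embed arr cC MB.
exists b, [set phi (widen_ord kn i) | i : 'I_k]; split.
- by apply/subsetP=> _ /imsetP[i _ ->].
- move=> _ _ /imsetP[i _ ->] /imsetP[j _ ->] neq; apply: H.
  rewrite /star_clique /= !ltn_ord !orbT andbT.
  by apply: contra neq => /eqP->.
- rewrite card_imset ?card_ord // => i j /phiI /(congr1 val) /= E.
  exact: val_inj.
Qed.

(** * Lower bounds for the Ramsey numbers of [star_clique] *)

Lemma arrows_star_clique_ge k n M : arrows (@star_clique k n) M -> n <= M.
Proof.
move=> arr; have cC : symmetric (fun _ _ : 'I_M => true) by [].
have [|b [phi [phiI _ _]]] := @arrows_embed _ _ _ _ _ [set: 'I_M] arr cC.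
  by rewrite cardsT card_ord.
by rewrite -[n]card_ord -[M]card_ord; apply: leq_card phiI.
Qed.

(* Burr's bound: colour [(k-1)(n-1)] vertices by [k-1] cliques of order [n-1]. *)
Lemma arrows_star_clique_gt k n M :
  1 < n -> 0 < k <= n -> arrows (@star_clique k n) M -> k.-1 * n.-1 < M.
Proof.
move=> n1 /andP[k0 kn] arr; rewrite ltnNge; apply/negP=> Mle.
pose c (i j : 'I_M) := i %/ n.-1 == j %/ n.-1.
have cC : symmetric c by move=> i j; rewrite /c eq_sym.
have [|b [phi [phiI _ H]]] := @arrows_embed _ _ _ _ _ [set: 'I_M] arr cC.
  by rewrite cardsT card_ord.
have n0 : 0 < n by lia.
have n10 : 0 < n.-1 by lia.
pose o := Ordinal n0; case: b H => H.
  (* All vertices are adjacent to the centre, so the copy lies in one block, which has only [n - 1]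
     vertices. *)
  have div j : phi j %/ n.-1 = phi o %/ n.-1.
    case: (eqVneq o j) => [<-//|neq].
    by apply/esym/eqP/H; rewrite /star_clique neq.
  have : injective (fun j => Ordinal (ltn_pmod (phi j) n10)).
    move=> i j [E]; apply/phiI/val_inj.
    by rewrite /= (divn_eq (phi i) n.-1) (divn_eq (phi j) n.-1) !div E.
  by move/leq_card; rewrite !card_ord; lia.
(* In colour [false] the [k] clique vertices need distinct blocks, but there are at most [k - 1]. *)
have lt (i : 'I_k) : phi (widen_ord kn i) %/ n.-1 < k.-1.
  by rewrite ltn_divLR //; apply: leq_trans (ltn_ord _) Mle.
have : injective (fun i => Ordinal (lt i)).
  move=> i j [/eqP E]; apply: contraTeq isT => neq.
  rewrite -[X in ~~ X]E -/(c _ _) H // /star_clique /= !ltn_ord !orbT andbT.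
  by apply: contra neq => /eqP/(congr1 val)/= ?; apply/eqP/val_inj.
by move/leq_card; rewrite !card_ord; lia.
Qed.


Lemma leq_bin_exp n k : 'C(n, k) <= n ^ k.
Proof.
apply: leq_trans (_ : n ^_ k <= _).
  by rewrite -bin_ffact leq_pmulr // fact_gt0.
by rewrite ffact_prod -[k in leqRHS]card_ord -prod_nat_const leq_prod // => i _; exact: leq_subr.
Qed.

(* Erdos' lower bound for diagonal Ramsey numbers, by counting the edge sets
   [D] of graphs on ['I_M]. *)
Lemma arrows_star_clique_exp k n M :
  k <= n -> arrows (@star_clique k n) M -> 2 ^ 'C(k, 2) <= 2 * M ^ k.
Proof.
move=> kn arr.
pose P (Q : {set 'I_M}) := [set e : {set 'I_M} | e \subset Q & #|e| == 2].
(* A family [D] may contain subsets of any size; only its pairs matter, and the others contribute a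
   common factor that cancels. *)
pose T := #|{set 'I_M}|.
pose bad (Q : {set 'I_M}) := [set D : {set {set 'I_M}} | P Q \subset D] :|: powerset (~: P Q).
have cover : [set: {set {set 'I_M}}] \subset \bigcup_(Q in [set Q : {set 'I_M} | #|Q| == k]) bad Q.
  apply/subsetP=> D _; pose c (x y : 'I_M) := [set x; y] \in D.
  have cC : symmetric c by move=> x y; rewrite /c setUC.
  have [|b [Q [_ mQ cQ]]] := arrows_star_clique kn arr cC (B := setT).
    by rewrite cardsT card_ord.
  have inP e : e \in P Q -> (e \in D) = b.
    rewrite inE => /andP[eQ /cards2P[x [y [neq E]]]]; subst e.
    by move: eQ; rewrite subUset !sub1set => /andP[xQ yQ]; exact: mQ.
  apply/bigcupP; exists Q; rewrite !inE ?cQ //.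
  case: b {mQ} inP => inP; apply/orP; [left|right]; apply/subsetP=> e.
    by move/inP.
  by move=> eD; rewrite inE; apply/negP=> /inP; rewrite eD.
have card_bad (Q : {set 'I_M}) : #|Q| = k -> #|bad Q| * 2 ^ 'C(k, 2) <= 2 * 2 ^ T.
  move=> cQ; have cP : #|P Q| = 'C(k, 2) by rewrite cards_draws cQ.
  have cN : #|~: P Q| + 'C(k, 2) = T by rewrite -cP addnC cardsC.
  have sup : #|[set D : {set {set 'I_M}} | P Q \subset D]| <= 2 ^ #|~: P Q|.
    rewrite -card_powerset -[leqLHS](card_in_imset (f := fun D => D :\: P Q)).
      by apply/subset_leq_card/subsetP=> _ /imsetP[D _ ->]; rewrite inE setDE subsetIr.
    move=> D E; rewrite !inE => /setIidPr PD /setIidPr PE DE.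
    by rewrite -(setID D (P Q)) -(setID E (P Q)) PD PE DE.
  rewrite -cN expnD mulnA leq_mul2r mul2n -addnn; apply/orP; right.
  apply: leq_trans (leq_card_setU _ _) _.
  by rewrite card_powerset leq_add2r.
have := subset_leq_card cover.
rewrite -powersetT card_powerset cardsT => /leq_trans/(_ (leq_card_bigcup _ _)).
rewrite -(leq_pmul2r (_ : 0 < 2 ^ 'C(k, 2))) ?expn_gt0 // big_distrl /=.
move=> H; have {H} : 2 ^ T * 2 ^ 'C(k, 2) <= 'C(M, k) * (2 * 2 ^ T).
  apply: leq_trans H _; rewrite -[M in 'C(M, k)]card_ord -card_draws -sum_nat_const.
  by apply: leq_sum => Q; rewrite inE => /eqP/card_bad.
rewrite mulnCA [2 ^ T * _]mulnC mulnA leq_pmul2r ?expn_gt0 // => H.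
by apply: leq_trans H _; rewrite leq_mul2l leq_bin_exp.
Qed.

(** * Numerical estimates *)

Lemma leq_exp_mul a b d e m : a ^ e <= b * d ^ e -> a ^ (e * m) <= b ^ m * d ^ (e * m).
Proof.
move=> le; rewrite !expnM -expnMn; elim: m => // m IH.
by rewrite !expnS leq_mul.
Qed.

Lemma exp16_15 m : 16 ^ (8 * m) <= 2 ^ m * 15 ^ (8 * m).
Proof. by apply: leq_exp_mul; lia. Qed.

(** Since [(16/15)^8 <= 2], the upper bound gives [M^4 <= 2^(k + 32 s + 16)], with [32 s <= k/2].
    Put into the lower bound, this gives [k^2 / 2 <= 18 k + 4], which is false for [k >= 98]. *)
Lemma exp_size_absurd k s M :
  98 <= k -> 64 * s <= k -> M * 15 ^ (2 * k) <= 16 ^ (2 * k) * 16 ^ (2 * s + 1) ->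
  2 ^ 'C(k, 2) <= 2 * M ^ k -> False.
Proof.
move=> k100 sk up low.
have M4 : M ^ 4 <= 2 ^ (k + 32 * s + 16).
  have H : (M * 15 ^ (2 * k)) ^ 4 <= (16 ^ (2 * k) * 16 ^ (2 * s + 1)) ^ 4.
    by rewrite leq_exp2r.
  rewrite !expnMn -!expnM (_ : 2 * k * 4 = 8 * k) in H; last by lia.
  have E : 16 ^ ((2 * s + 1) * 4) = 2 ^ (32 * s + 16).
    by rewrite -[16]/(2 ^ 4) -expnM; congr (_ ^ _); lia.
  rewrite E in H; rewrite -(leq_pmul2r (_ : 0 < 15 ^ (8 * k))) ?expn_gt0 //.
  apply: leq_trans H _; rewrite -addnA (expnD 2 k).
  by rewrite [leqRHS]mulnAC leq_mul2r exp16_15 orbT.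
have H : (2 ^ 'C(k, 2)) ^ 4 <= (2 * M ^ k) ^ 4 by rewrite leq_exp2r.
have {}H : 2 ^ ('C(k, 2) * 4) <= 2 ^ (4 + (k + 32 * s + 16) * k).
  rewrite expnM; apply: leq_trans H _.
  rewrite expnMn (expnD 2 4) leq_mul2l -(expnM M) [k * 4]mulnC (expnM M) (expnM 2).
  by rewrite leq_exp2r ?M4 ?orbT //; lia.
rewrite leq_exp2l // in H.
have := bin2_sum k; have := mul_bin_diag k 1.
rewrite bin1; nia.
Qed.

(** Chains the bounds of [common_nbrs] and [card_no_mono], with [u = |U|], [v = |U'|], [t = |X|],
    [s' = |S|]. The exponent [t + k + 1] is padded to [2 k]. *)
Lemma exp_bounds_combine q k t s s' M u v :
  M <= u -> u * q ^ t <= q.+1 ^ t * (q ^ s' * v) -> s' <= s ->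
  v.+1 * q ^ k.+1 <= q.+1 ^ (k.+1 + s.+1) -> t < k ->
  M * q ^ (2 * k) <= q.+1 ^ (2 * k) * q.+1 ^ (2 * s + 1).
Proof.
move=> Mu Hu s's Hv tk.
case: (posnP q) => [->|q0].
  by rewrite exp0n ?muln0 //; case: k tk {Hv}.
have step : M * q ^ (t + k.+1) <= q.+1 ^ (t + k.+1) * q.+1 ^ (2 * s + 1).
  rewrite expnD mulnA.
  apply: leq_trans (_ : q.+1 ^ t * (q ^ s' * v) * q ^ k.+1 <= _).
    by rewrite leq_mul2r (leq_trans (leq_mul Mu (leqnn _)) Hu) orbT.
  rewrite -!mulnA [q.+1 ^ (t + _)]expnD -[leqRHS]mulnA leq_mul2l; apply/orP; right.
  rewrite (_ : q.+1 ^ k.+1 * _ = q.+1 ^ s * q.+1 ^ (k.+1 + s.+1)); last first.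
    by rewrite -!expnD; congr (_ ^ _); rewrite mul2n -addnn; lia.
  apply: leq_mul.
    apply: leq_trans (_ : q.+1 ^ s' <= _); last by rewrite leq_pexp2l.
    by case: (s') => // m; rewrite leq_exp2r.
  by apply: leq_trans Hv; rewrite leq_mul2r leqnSn orbT.
have -> : 2 * k = (t + k.+1) + (k - t.+1) by lia.
rewrite !(expnD _ (t + k.+1)) mulnA.
rewrite [leqRHS]mulnAC; apply: leq_mul.
  by [].
by case: (k - t.+1) => // m; rewrite leq_exp2r.
Qed.

(** * The step from [k] to [k + 1] *)

Lemma sum_card_nbrs (T : finType) (c : rel T) b (A X : {set T}) :
  symmetric c ->
  \sum_(y in A) #|X :&: nbrs c b y| = \sum_(x in X) #|A :&: nbrs c b x|.
Proof.
move=> cC.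
have card (B : {set T}) y : #|B :&: nbrs c b y| = \sum_(x in B) (x \in nbrs c b y).
  rewrite -sum1_card (eq_bigl (fun x => (x \in B) && (x \in nbrs c b y))).
    by rewrite big_mkcondr; apply: eq_bigr => x _; case: (x \in _).
  by move=> x; rewrite inE.
rewrite (eq_bigr _ (fun y _ => card _ y)) exchange_big.
by apply: eq_bigr => x _; rewrite card; apply: eq_bigr => y _; rewrite !inE eq_sym cC.
Qed.


Lemma arrows_star_cliqueS k n M :
  0 < k < n -> arrows (@star_clique k n) M -> arrows (@star_clique k.+1 n) (200 * M).
Proof.
case/andP=> k0 kn arr; have kn' := ltnW kn.
have nM := arrows_star_clique_ge arr.
have burr : k.-1 * n.-1 < M by apply: (arrows_star_clique_gt _ _ arr); lia.
have lowM := arrows_star_clique_exp kn' arr.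
apply: star_clique_arrows => // c cC.
set goal := exists b x Q, _.
case: (ClassicalEpsilon.excluded_middle_informative goal) => // none; exfalso.
have noK b x (Q : {set 'I_(200 * M)}) :
    mono c b Q -> x \in Q -> k < #|Q| -> #|nbrs c b x| < n.-1.
  by move=> *; rewrite ltnNge; apply/negP=> ?; apply: none; exists b, x, Q; split.
have N0 : 0 < 200 * M by lia.
pose x0 := Ordinal N0.
(* The majority colour [b] at [x0] is called blue, and [~~ b] red. *)
have [b big] : exists b, 100 * M <= #|nbrs c b x0|.+1.
  have := nbrs_split c true (in_setT x0); rewrite !setTI cardsT card_ord /=.
  case: (leqP (100 * M) #|nbrs c true x0|.+1) => [|lt E]; first by exists true.
  by exists false; move: lt E; move: #|_| #|_| => p q; clear; lia.
pose A0 := nbrs c b x0; rewrite -/A0 in big.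
have A0b (Q : {set 'I_(200 * M)}) : Q \subset A0 -> mono c b Q -> #|Q| < k.
  move=> sQ mQ; rewrite ltnNge; apply/negP=> kQ.
  have := noK b x0 (x0 |: Q) (monoU1 cC mQ sQ) (setU11 _ _).
  by rewrite (cardU1_nbrs sQ) ltnS -/A0 => /(_ kQ); lia.
pose A := [set x in A0 | n.-1 <= #|nbrs c (~~ b) x|].
have AA0 : A \subset A0 by apply/subsetP=> x; rewrite inE => /andP[].
(* Otherwise the red neighbourhood of [x] in [A] contains a monochromatic [K_k]: a blue one
   contradicts [A0b], and a red one extends by [x], whose red degree is at least [n - 1]. *)
have Adeg x : x \in A -> #|A :&: nbrs c (~~ b) x| < M.
  move=> xA; rewrite ltnNge; apply/negP=> /(arrows_star_clique kn' arr cC).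
  case=> e [Q []]; rewrite subsetI => /andP[QA Qn] mQ cQ.
  case: (eqVneq e b) => [E|neq].
    by move: mQ; rewrite E => /(A0b _ (subset_trans QA AA0)); rewrite cQ ltnn.
  have {neq} E : e = ~~ b by move: neq; case: (e); case: (b).
  rewrite E in mQ; have := noK _ x _ (monoU1 cC mQ Qn) (setU11 _ _).
  rewrite (cardU1_nbrs Qn) cQ => /(_ (leqnn _)); rewrite ltnNge.
  by move: xA; rewrite inE => /andP[_ ->].
have Ar (Q : {set 'I_(200 * M)}) : Q \subset A -> mono c (~~ b) Q -> #|Q| < k.+1.
  move=> sQ mQ; rewrite ltnNge; apply/negP=> kQ.
  have : 0 < #|Q| := leq_ltn_trans (leq0n k) kQ.
  rewrite card_gt0 => /set0Pn[x xQ]; have := noK _ x _ mQ xQ kQ.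
  by rewrite ltnNge; move: (subsetP sQ _ xQ); rewrite inE => /andP[_ ->].
(* In [A0 :\: A] red degrees are below [n - 1] and blue cliques have fewer than [k] vertices, so its
   size is at most [(k-1)(n-1) < M]. *)
have cA : 98 * M <= #|A|.
  have [X [XA mX max]] := max_mono c b (A0 :\: A).
  have XA0 := subset_trans XA (subsetDl _ _).
  have deg : {in A0 :\: A, forall x, #|(A0 :\: A) :&: nbrs c (~~ b) x| < n.-1}.
    move=> x; rewrite !inE => /andP[nA xA0]; apply: leq_ltn_trans (_ : #|nbrs c (~~ b) x| < _).
      exact/subset_leq_card/subsetIr.
    by move: nA; rewrite xA0 ltnNge.
  have := card_max_mono cC XA mX max deg; have := A0b _ XA0 mX.
  have := cardsID A A0; rewrite (setIidPr AA0) => E lt le.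
  have Xn : #|X| * n.-1 <= k.-1 * n.-1 by apply: leq_mul => //; rewrite -ltnS prednK.
  move: (leq_trans le (leq_trans Xn (ltnW burr))) E big.
  by clear -nM k0 kn; move: #|_ :\: _| #|A0| #|A|; lia.
have [X [XA mX max]] := max_mono c b A.
have XM := card_max_mono cC XA mX max Adeg.
have Xk : #|X| < k by apply: A0b => //; apply: subset_trans AA0.
have X98 : 98 <= #|X| by nia.
pose s := #|X| %/ 64.
pose U := [set y in A :\: X | #|X :&: nbrs c (~~ b) y| <= s].
(* At most [|X| M] red pairs run between [X] and [A], and [|X| < 64 (s + 1)], so fewer than [64 M]
   vertices have more than [s] red neighbours in [X]; also [|X| < M]. *)
have cU : M <= #|U|.
  pose W := [set y in A | s < #|X :&: nbrs c (~~ b) y|].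
  have AUW : A \subset X :|: U :|: W.
    apply/subsetP=> y yA; rewrite !in_setU; case: (boolP (y \in X)) => //= nX.
    by rewrite [y \in U]inE [y \in W]inE in_setD nX yA /=; case: leqP.
  have cW : #|W| * s.+1 <= #|X| * M.
    rewrite -sum_nat_const; apply: leq_trans (_ : _ <= \sum_(x in X) #|A :&: nbrs c (~~ b) x|) _.
      have WA : W \subset A by apply/subsetP=> y; rewrite inE => /andP[].
      rewrite -sum_card_nbrs // [leqRHS](big_setID W) /= (setIidPr WA).
      apply: leq_trans (leq_addr _ _); apply: leq_sum => y.
      by rewrite inE => /andP[].
    rewrite -sum_nat_const; apply: leq_sum => x xX.
    by apply/ltnW/Adeg/(subsetP XA).
  have : #|A| <= #|X| + #|U| + #|W|.
    apply: leq_trans (subset_leq_card AUW) _.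
    apply: leq_trans (leq_card_setU _ _) _; rewrite leq_add2r.
    exact: leq_card_setU.
  have : #|X| < s.+1 * 64 by rewrite -ltn_divLR.
  by clear -cW cA Xk kn nM; nia.
have [S [U' [SX U'U Hb Hr Hc]]] := @common_nbrs _ c 15 b (enum X) U isT (enum_uniq X).
have U'A : U' \subset A :\: X.
  by apply: subset_trans U'U _; apply/subsetP=> y; rewrite inE => /andP[].
have U'0 : 0 < #|U'|.
  case: (posnP #|U'|) => // E; move: Hc.
  rewrite E !muln0 leqn0 muln_eq0 expn_eq0 /= orbF => /eqP E0.
  by move: cU (leq_ltn_trans k0 kn); rewrite E0 leqn0 => /eqP M0; move: nM; rewrite M0; case: (n).
(* Any [y] in the nonempty [U'] is joined in red to all of [S], and has at most [s] red neighbours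
   in [X]. *)
have cS : #|S| <= s.
  move: U'0; rewrite card_gt0 => /set0Pn[y yU'].
  have := subsetP U'U _ yU'; rewrite inE => /andP[yX].
  apply: leq_trans; apply/subset_leq_card/subsetP=> x xS.
  have xX : x \in X by rewrite -mem_enum SX.
  rewrite !inE xX cC (Hr _ _ xS yU') eqxx andbT.
  by apply/eqP=> E; move: yX; rewrite -E !inE xX.
(* Exchanging [S] for [Q] in [X] gives a blue clique in [A], so [|Q| <= |S|] by maximality. *)
have U'b (Q : {set 'I_(200 * M)}) : Q \subset U' -> mono c b Q -> #|Q| < s.+1.
  move=> QU' mQ; have QAX := subset_trans QU' U'A.
  have SX' : S \subset X by apply/subsetP=> x /SX; rewrite mem_enum.
  have m : mono c b ((X :\: S) :|: Q).
    apply: monoU => //.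
      by move=> x y /setDP[xX _] /setDP[yX _]; apply: mX.
    by move=> x y /setDP[xX xS] /(subsetP QU') yU'; apply: Hb => //; rewrite mem_enum.
  have sub : (X :\: S) :|: Q \subset A.
    rewrite subUset (subset_trans (subsetDl _ _) XA) /=.
    exact: subset_trans QAX (subsetDl _ _).
  have := max _ sub m; rewrite cardsU.
  have -> : (X :\: S) :&: Q = set0.
    apply/setP=> x; rewrite !inE; apply/negP=> /andP[/andP[_ xX] xQ].
    by move: (subsetP QAX _ xQ); rewrite inE xX.
  rewrite cards0 subn0 cardsD (setIidPr SX').
  have arith p q r e : p - q + r <= p -> q <= p -> q <= e -> r < e.+1 by clear; lia.
  by move/arith; apply => //; exact: subset_leq_card.
have U'r (Q : {set 'I_(200 * M)}) : Q \subset U' -> mono c (~~ b) Q -> #|Q| < k.+1.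
  by move=> QU'; apply: Ar; apply: subset_trans QU' (subset_trans U'A (subsetDl _ _)).
have up := card_no_mono 15 cC U'r; rewrite negbK in up; have {}up := up _ U'b.
rewrite -cardE in Hc.
have sX : s * 64 <= #|X| := leq_divM _ _.
apply: (@exp_size_absurd k s M) lowM.
- exact: leq_trans X98 (ltnW Xk).
- by rewrite mulnC (leq_trans sX) // ltnW.
- exact: exp_bounds_combine cU Hc cS up Xk.
Qed.

(** * Interpolation between the star and the complete graph *)

Lemma arrows_star1 n : 0 < n -> arrows (@star_clique 1 n) (2 * n).
Proof.
move=> n0; apply: star_clique_arrows => // c cC.
have N0 : 0 < 2 * n by lia.
pose x := Ordinal N0.
have [b big] : exists b, n.-1 <= #|nbrs c b x|.
  have := nbrs_split c true (in_setT x); rewrite !setTI cardsT card_ord /=.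
  have [|lt E] := leqP n.-1 #|nbrs c true x|; first by exists true.
  by exists false; move: lt E; move: #|_| #|_| => p q; clear; lia.
exists b, x, [set x]; rewrite set11 cards1; split=> //.
by move=> y z /set1P-> /set1P->; rewrite eqxx.
Qed.

Lemma ramsey_star_cliqueS k n :
  0 < k < n ->
  ramsey (@star_clique k.+1 n) <= 200 * ramsey (@star_clique k n).
Proof.
case/andP=> k0 kn; apply/ramsey_leq/arrows_star_cliqueS; first by rewrite k0.
(* Some [N] must satisfy the arrow relation, so that [ramsey] is not its dummy value 0. *)
suff [N] : exists N, arrows (@star_clique k n) N by apply: arrows_ramsey.
elim: k k0 kn => [//|[_ _ n1|k IH _ kn]].
  by exists (2 * n); apply/arrows_star1/ltnW.
have [|N arr] := IH isT; first exact: ltnW.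
by exists (200 * N); apply: arrows_star_cliqueS arr; exact: ltnW.
Qed.

Lemma ramsey_star_clique_interpolation n N :
  0 < n -> n <= N <= ramsey (complete_graph n) ->
  exists k, N <= ramsey (@star_clique k n) <= 200 * N.
Proof.
move=> n0 /andP[nN Nr].
pose P k := (0 < k) && (N <= ramsey (@star_clique k n)).
have ex : exists k, P k.
  by exists n; rewrite /P n0 (eq_ramsey (@star_clique_complete n)).
case: (ex_minnP ex) => -[|[|k]] /andP[k0 Nk] kmin //.
  exists 1; rewrite Nk (leq_trans (ramsey_leq (arrows_star1 n0))) //.
  by apply: leq_mul.
have kn : k.+1 < n.
  by apply: kmin; rewrite /P n0 (eq_ramsey (@star_clique_complete n)).
exists k.+2; rewrite Nk (leq_trans (ramsey_star_cliqueS _)) // leq_mul2l /=.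
(* By minimality of [k + 2], the Ramsey number of [G(k+1, n)] is below [N]. *)
by rewrite leqNgt; apply/negP=> /ltnW lt; have := kmin k.+1; rewrite /P lt ltnn => /(_ isT).
Qed.

Theorem theorem1p1 :
  exists C n0 : nat, 0 < C /\ 0 < n0 /\
    forall f : nat -> nat,
      (forall m n, m <= n -> f m <= f n) ->
      (forall n, n <= f n <= ramsey (complete_graph n)) ->
      exists G : forall n : nat, rel 'I_n,
        (forall n, simple_graph (G n) /\ connected_graph (G n)) /\
        (forall n, n0 <= n ->
           f n <= ramsey (G n) <= C * f n).
Proof.
exists 200, 1; do 2!split=> //; move=> f _ fb.
(* The boolean guard makes [xchoose] applicable at every [n], with an arbitrary [k] at [n = 0]. *)
have ex n : exists k, (0 < n) ==> (f n <= ramsey (@star_clique k n) <= 200 * f n).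
  have [n0|n0] := posnP n; first by exists 0; rewrite n0.
  by have [k Hk] := ramsey_star_clique_interpolation n0 (fb n); exists k; rewrite Hk implybT.
exists (fun n => @star_clique (xchoose (ex n)) n); split=> n.
  by split; [exact: star_clique_simple | exact: star_clique_connected].
by move=> n0; exact: (implyP (xchooseP (ex n)) n0).
Qed.
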